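(* Let $n \geq 2$ be an integer, $0 < p < 1$, and $T$ a real number with $1 \leq T \leq n$. Let $P^*(n,p,T)$ be the maximum of the probability of successful recovery $P(x_1,\ldots,x_n)$ over all allocations of the budget $T$ (i.e. over all real $x_1,\ldots,x_n \geq 0$ with $\sum_{i=1}^n x_i \leq T$), and let $\bar{P}(n,p,T)$ be the probability of successful recovery for the symmetric allocation $\bar{\mathbf{x}}(n,T,n) = \{\frac{T}{n},\ldots,\frac{T}{n}\}$. Then $$P^*(n,p,T) - \bar{P}(n,p,T) \;\leq\; pT\, \mathbb{P}\left[\mathcal{B}(n-1,p) \leq \left\lceil \frac{n}{T} \right\rceil - 2\right].$$ Moreover, if $p$ and $T$ are fixed such that $T > \frac{1}{p}$, then the gap $P^*(n,p,T) - \bar{P}(n,p,T)$ approaches $0$ as $n \to \infty$.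
   Context: There are $n$ storage nodes; node $i$ stores an amount $x_i \geq 0$ of data. An allocation of the budget $T$ is a choice of real numbers $x_1,\ldots,x_n \geq 0$ with $\sum_{i=1}^n x_i \leq T$. Each node is accessed independently with probability $p$; let $\mathbf{r} \subseteq \{1,\ldots,n\}$ be the random set of accessed nodes. Successful recovery is the event $\sum_{i\in\mathbf{r}} x_i \geq 1$, so the probability of successful recovery is $$P(x_1,\ldots,x_n) = \sum_{\mathbf{r} \subseteq \{1,\ldots,n\}} p^{|\mathbf{r}|}(1-p)^{n-|\mathbf{r}|}\,\mathbf{I}\Big[\sum_{i\in\mathbf{r}} x_i \geq 1\Big],$$ where $\mathbf{I}[G]=1$ if $G$ is true and $0$ otherwise. $\mathcal{B}(N,p)$ denotes a binomial random variable with $N$ trials and success probability $p$. *)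

(* Defs.v *)
From HB Require Import structures.
From mathcomp Require Import all_boot all_order all_algebra.
From mathcomp Require Import all_classical all_reals all_analysis.

Set Implicit Arguments.
Unset Strict Implicit.
Unset Printing Implicit Defensive.

Import Order.TTheory GRing.Theory Num.Theory.

Local Open Scope classical_set_scope.
Local Open Scope ring_scope.

Section Allocation.
Context {R : realType}.

Definition allocations (n : nat) (T : R) : set ('I_n -> R) :=
  [set x | (forall i, 0 <= x i) /\ \sum_(i < n) x i <= T].

Definition recovery_prob (n : nat) (p : R) (x : 'I_n -> R) : R :=
  \sum_(r : {set 'I_n})
     p ^+ #|r| * (1 - p) ^+ (n - #|r|) * (1 <= \sum_(i in r) x i)%R%:R.

(* For T >= 0 this supremum is an attained maximum, see opt_recovery_probP. *)
Definition opt_recovery_prob (n : nat) (p T : R) : R :=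
  sup [set recovery_prob p x | x in @allocations n T].

Definition max_spread_prob (n : nat) (p T : R) : R :=
  recovery_prob p (fun _ : 'I_n => T / n%:R).

Lemma opt_recovery_probP (n : nat) (p T : R) : 0 <= T ->
  (exists2 x, @allocations n T x & recovery_prob p x = opt_recovery_prob n p T)
  /\ (forall x, @allocations n T x ->
        recovery_prob p x <= opt_recovery_prob n p T).
Proof.
move=> T0.
pose fam (x : 'I_n -> R) := [set r : {set 'I_n} | 1 <= \sum_(i in r) x i]%SET.
pose val (F : {set {set 'I_n}}) : R :=
  \sum_(r : {set 'I_n}) p ^+ #|r| * (1 - p) ^+ (n - #|r|) * (r \in F)%:R.
have valE x : recovery_prob p x = val (fam x).
  by apply: eq_bigr => r _; rewrite inE.
have A0 : @allocations n T (fun=> 0) by split=> //; rewrite big1.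
pose Q F := `[< exists2 x, @allocations n T x & fam x = F >].
have Q0 : Q (fam (fun=> 0)) by apply/asboolP; exists (fun=> 0).
have [F /asboolP[x Ax <-] Fmax] := arg_maxP val Q0.
have ub y : @allocations n T y -> recovery_prob p y <= recovery_prob p x.
  by move=> Ay; rewrite !valE; apply: Fmax; apply/asboolP; exists y.
suff -> : opt_recovery_prob n p T = recovery_prob p x by split=> //; exists x.
apply/eqP; rewrite eq_le; apply/andP; split.
  by apply: ge_sup; [exists (recovery_prob p x), x|move=> _ [y Ay <-]; exact: ub].
apply: ub_le_sup; last by exists x.
by exists (recovery_prob p x) => _ [y Ay <-]; exact: ub.
Qed.

End Allocation.

(* Main.v *)
(* An allocation gains over the symmetric one only on the sets r with
   |r| T < n. There the indicator of sum_(i in r) x_i >= 1 is at most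
   sum_(i in r) x_i (Markov), so exchanging sums bounds the gain by
   sum_i x_i P[i in r, |r| T < n], and each of these probabilities equals
   p P[B(n-1,p) + 1 < n/T], independently of i. For T > 1/p the gap is also at
   most P[B(n,p) < n/T], which vanishes by Chebyshev's inequality since the
   mean np exceeds n/T by an amount linear in n. *)
Require Import Defs.
From HB Require Import structures.
From mathcomp Require Import all_boot all_order all_algebra.
From mathcomp Require Import zify ring lra.
From mathcomp Require Import all_classical all_reals all_analysis.

Set Implicit Arguments.
Unset Strict Implicit.
Unset Printing Implicit Defensive.

Import Order.TTheory GRing.Theory Num.Theory.
Import numFieldNormedType.Exports.

Local Open Scope classical_set_scope.
Local Open Scope ring_scope.

(** * Sums over sets of a function of the cardinality *)

Lemma sum_card_subset (V : nmodType) (I : finType) (B : {set I}) (F : nat -> V) :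
  \sum_(s : {set I} | s \subset B) F #|s| =
  \sum_(k < #|B|.+1) F k *+ 'C(#|B|, k).
Proof.
(* The sets are grouped by cardinality; [inord] is faithful here because a subset of B has at most
   [#|B|] elements. *)
rewrite (partition_big (fun s : {set I} => inord #|s| : 'I_#|B|.+1) predT)//=.
apply: eq_bigr => k _; rewrite -cards_draws -sumr_const.
have subE (s : {set I}) : (s \subset B) && (inord #|s| == k) =
    (s \in [set A : {set I} | A \subset B & #|A| == k]%SET).
  rewrite inE; have [sB|//] := boolP (s \subset B).
  by rewrite -val_eqE /= inordK// ltnS subset_leq_card.
rewrite (eq_bigl _ _ subE); apply: eq_bigr => s.
by rewrite inE => /andP[_ /eqP ->].
Qed.

(** Removing i is a bijection onto the subsets of the complement of i and lowers the cardinality by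
    one. *)
Lemma sum_card_mem (V : nmodType) (I : finType) (i : I) (F : nat -> V) :
  \sum_(r : {set I} | i \in r) F #|r| =
  \sum_(k < #|I|.-1.+1) F k.+1 *+ 'C(#|I|.-1, k).
Proof.
have <- : #|~: [set i]%SET| = #|I|.-1 by rewrite cardsC1.
rewrite -(@sum_card_subset _ _ (~: [set i])%SET (fun k => F k.+1)).
rewrite (reindex_onto (fun s : {set I} => i |: s)%SET (fun r => r :\ i)%SET);
  last by move=> r ir; rewrite finset.setD1K.
have memE (s : {set I}) : (i \in (i |: s))%SET && (((i |: s) :\ i)%SET == s) =
    (s \subset ~: [set i])%SET.
  rewrite finset.setU11/= finset.subsetC finset.sub1set inE; apply/eqP/idP => [<-|si].
    by rewrite !inE eqxx.
  by rewrite finset.setU1K.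
rewrite (eq_bigl _ _ memE); apply: eq_bigr => s.
by rewrite finset.subsetC finset.sub1set inE => si; rewrite cardsU1 si.
Qed.

(** * Binomial expectations as finite real sums *)

Section Binomial.
Context {R : realType}.
Implicit Types (p : R) (n : nat) (f : nat -> R).

Definition bin_mean n p f : R := \sum_(k < n.+1) binomial_pmf n p k * f k.

Lemma binomial_prob_mean n p (U : set nat) : 0 <= p <= 1 ->
  binomial_prob n p U = (bin_mean n p (fun k => (k \in U)%:R))%:E.
Proof.
move=> /andP[p0 p1]; rewrite (@binomial_probE _ n p p0 p1) -sumEFin.
by apply: eq_bigr => k _; rewrite diracE EFinM.
Qed.

Lemma sum_set_mean n p f :
  \sum_(r : {set 'I_n}) p ^+ #|r| * (1 - p) ^+ (n - #|r|) * f #|r| =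
  bin_mean n p f.
Proof.
rewrite (eq_bigl (fun r : {set 'I_n} => r \subset [set: 'I_n]%SET));
  last by move=> r; rewrite finset.subsetT.
rewrite (@sum_card_subset _ _ _ (fun k => p ^+ k * (1 - p) ^+ (n - k) * f k)).
rewrite cardsT card_ord; apply: eq_bigr => k _.
by rewrite /binomial_pmf mulrnAl.
Qed.

(** Access to node i contributes the factor p; the number of other accessed nodes is binomial with n
    - 1 trials. *)
Lemma sum_set_mem_mean n p f (i : 'I_n) :
  \sum_(r : {set 'I_n} | i \in r)
     p ^+ #|r| * (1 - p) ^+ (n - #|r|) * f #|r| =
  p * bin_mean n.-1 p (fun k => f k.+1).
Proof.
rewrite (@sum_card_mem _ _ i (fun k => p ^+ k * (1 - p) ^+ (n - k) * f k)).
rewrite card_ord mulr_sumr; apply: eq_bigr => k _.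
have -> : (n - k.+1 = n.-1 - k)%N by case: n i k => [[]|] *; rewrite ?subSS.
by rewrite /binomial_pmf exprS !mulrnAl mulrnAr !mulrA.
Qed.

Lemma bin_mean1 n p : bin_mean n p (fun=> 1) = 1.
Proof.
rewrite -[RHS](expr1n _ n) -[in RHS](subrK p 1) exprDn.
by apply: eq_bigr => k _; rewrite mulr1 /binomial_pmf mulrC.
Qed.

Lemma bin_mean_le n p f g : 0 <= p <= 1 -> (forall k, f k <= g k) ->
  bin_mean n p f <= bin_mean n p g.
Proof.
by move=> p01 fg; apply: ler_sum => k _; rewrite ler_wpM2l ?binomial_pmf_ge0.
Qed.

(** Conditioning on one trial, that is, Pascal's rule. *)
Lemma bin_meanS n p f :
  bin_mean n.+1 p f =
  (1 - p) * bin_mean n p f + p * bin_mean n p (fun k => f k.+1).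
Proof.
have -> : bin_mean n p f = \sum_(k < n.+2) binomial_pmf n p k * f k.
  by rewrite big_ord_recr/= [binomial_pmf _ _ n.+1]/binomial_pmf bin_small//
    mulr0n mul0r addr0.
rewrite /bin_mean big_ord_recl [in RHS]big_ord_recl/= mulrDr -addrA.
congr (_ + _).
  by rewrite /binomial_pmf !bin0 !expr0 !mul1r !subn0 exprS mulrA.
rewrite !mulr_sumr -big_split/=; apply: eq_bigr => k _.
rewrite /bump leq0n add1n !mulrA -mulrDl; congr (_ * _).
rewrite /binomial_pmf binS mulrnDr subSS exprS !mulrnAr !mulrA; congr (_ + _).
(* For k >= n the truncated exponents no longer match, but ['C(n, k.+1)] vanishes. *)
have [kn|nk] := ltnP k n; last by rewrite bin_small.
by rewrite -(subnSK kn) exprS mulrCA !mulrA.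
Qed.

(** Variance plus squared bias. The centre c stays general because a success in the extra trial
    moves it to c - 1 in the induction. *)
Lemma bin_mean_sqr n p (c : R) :
  bin_mean n p (fun k => (k%:R - c) ^+ 2) =
  n%:R * p * (1 - p) + (n%:R * p - c) ^+ 2.
Proof.
elim: n c => [|n IHn] c.
  rewrite /bin_mean big_ord1 /binomial_pmf bin0 !expr0 mulr1n/=.
  by ring.
rewrite bin_meanS IHn; under [X in _ + p * X]eq_bigr => k _.
  rewrite (_ : k.+1%:R - c = k%:R - (c - 1)); last by rewrite -natr1; ring.
  over.
by rewrite -/(bin_mean n p (fun k => (k%:R - (c - 1)) ^+ 2)) IHn -natr1; ring.
Qed.

Lemma bin_mean_chebyshev n p (e : R) : 0 <= p <= 1 -> 0 < e ->
  bin_mean n p (fun k => (k%:R <= n%:R * p - e)%R%:R) <=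
  n%:R * p * (1 - p) / e ^+ 2.
Proof.
move=> p01 e0; rewrite ler_pdivlMr ?exprn_gt0//.
have -> : n%:R * p * (1 - p) = bin_mean n p (fun k => (k%:R - n%:R * p) ^+ 2).
  by rewrite bin_mean_sqr subrr expr0n addr0.
rewrite mulrC mulr_sumr; apply: ler_sum => k _.
rewrite mulrCA ler_wpM2l ?binomial_pmf_ge0//.
(* On the event, k lies at least e below the mean, so its squared deviation is at least [e ^+ 2]. *)
case: (leP k%:R) => ke; rewrite ?mulr0 ?sqr_ge0// mulr1.
by rewrite -[leRHS]sqrrN opprB ler_sqr ?nnegrE; lra.
Qed.

End Binomial.

(** * Bounds on the gap to the symmetric allocation *)

Section Gap.
Context {R : realType}.
Implicit Types (p T : R) (n : nat).

Lemma recovery_prob_le1 n p (x : 'I_n -> R) : 0 <= p <= 1 ->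
  recovery_prob p x <= 1.
Proof.
move=> /andP[p0 p1]; rewrite -(bin_mean1 n p) -sum_set_mean.
apply: ler_sum => r _; rewrite ler_wpM2l ?mulr_ge0 ?exprn_ge0 ?subr_ge0//.
by rewrite lern1 leq_b1.
Qed.

Lemma max_spread_allocation n T : 0 <= T ->
  @allocations R n T (fun=> T / n%:R).
Proof.
move=> T0; split=> [i|]; first by rewrite divr_ge0.
rewrite sumr_const card_ord -[_ *+ n]mulr_natr.
by have [->|n0] := eqVneq n 0%N; rewrite ?mulr0// divfK// pnatr_eq0.
Qed.

Lemma max_spread_probE n p T : (0 < n)%N ->
  max_spread_prob n p T = bin_mean n p (fun k => (n%:R <= k%:R * T)%R%:R).
Proof.
move=> n0; rewrite -sum_set_mean; apply: eq_bigr => r _.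
rewrite sumr_const -[_ *+ #|_|]mulr_natl [_ * (T / _)]mulrA.
by rewrite ler_pdivlMr ?ltr0n// mul1r.
Qed.

Lemma recovery_gap n p T (x : 'I_n -> R) : (0 < n)%N -> 0 <= p <= 1 ->
  allocations T x ->
  recovery_prob p x - max_spread_prob n p T <=
  p * T * bin_mean n.-1 p (fun k => (k.+1%:R * T < n%:R)%R%:R).
Proof.
move=> n0 p01 [x0 xT]; have /andP[p0 p1] := p01.
pose w (r : {set 'I_n}) := p ^+ #|r| * (1 - p) ^+ (n - #|r|).
pose s k : R := (k%:R * T < n%:R)%R%:R.
have w0 r : 0 <= w r by rewrite mulr_ge0 ?exprn_ge0 ?subr_ge0.
have le1 : recovery_prob p x - max_spread_prob n p T <=
    \sum_(r : {set 'I_n}) \sum_(i in r) x i * (w r * s #|r|).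
  rewrite max_spread_probE// -sum_set_mean -sumrB; apply: ler_sum => r _.
  rewrite -mulrBr -mulr_suml mulrCA ler_wpM2l ?w0//.
  have X0 : 0 <= \sum_(i in r) x i by apply: sumr_ge0.
  rewrite /s; case: (leP n%:R (#|r|%:R * T)) => _;
    case: (leP 1 (\sum_(i in r) _)) => X1 /=; lra.
apply: (le_trans le1).
rewrite (exchange_big_dep predT)//=.
under eq_bigr => i _ do rewrite -mulr_sumr sum_set_mem_mean.
(* The mean is the same for every i, so it factors out and leaves the budget constraint [xT]. *)
rewrite -mulr_suml [p * T]mulrC -[leRHS]mulrA ler_wpM2r//.
by rewrite mulr_ge0// sumr_ge0// => k _; rewrite mulr_ge0 ?binomial_pmf_ge0.
Qed.

Lemma opt_gap_ge0 n p T : 0 <= T ->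
  0 <= opt_recovery_prob n p T - max_spread_prob n p T.
Proof.
move=> T0; rewrite subr_ge0; have [_] := opt_recovery_probP n p T0.
by apply; exact: max_spread_allocation.
Qed.

Lemma opt_gap_le n p T : (0 < n)%N -> 0 <= p <= 1 -> 0 < T -> T^-1 < p ->
  opt_recovery_prob n p T - max_spread_prob n p T <=
  p * (1 - p) / (p - T^-1) ^+ 2 * n%:R^-1.
Proof.
move=> n0 p01 T0 Tp; set d := p - T^-1.
have d0 : 0 < d by rewrite subr_gt0.
have nR : 0 < n%:R :> R by rewrite ltr0n.
have [[x _ <-] _] := opt_recovery_probP n p (ltW T0).
apply: (@le_trans _ _ (1 - max_spread_prob n p T)).
  by rewrite lerD2r recovery_prob_le1.
(* Chebyshev is applied with deviation n d, the distance from the mean n p down to n / T. *)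
have -> : p * (1 - p) / d ^+ 2 * n%:R^-1 =
    n%:R * p * (1 - p) / (n%:R * d) ^+ 2 by field; rewrite !gt_eqF.
apply: le_trans (bin_mean_chebyshev n p01 (mulr_gt0 nR d0)).
(* With 1 written as the mean of a constant, it remains to see that each k satisfies k <= n / T or n
   <= k T. *)
rewrite max_spread_probE// -[X in X - _](bin_mean1 n p) lerBlDr.
rewrite /bin_mean -big_split/=; under [leRHS]eq_bigr => k _ do rewrite -mulrDr.
apply: (@bin_mean_le _ n p (fun=> 1) (fun k =>
  (k%:R <= n%:R * p - n%:R * d)%R%:R + (n%:R <= k%:R * T)%R%:R)) => // k.
have [|kT] := leP n%:R (k%:R * T); first by rewrite lerDr.
have -> : k%:R <= n%:R * p - n%:R * d.
  by rewrite -mulrBr subKr ler_pdivlMr// ltW.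
by rewrite addr0.
Qed.

(** An integer is below the ceiling of y exactly when it is below y. Of the 2, one unit encodes
    strictness and the other the node already known to be accessed. *)
Lemma le_ceilB2 k (y : R) : (k%:Z <= Num.ceil y - 2)%R = (k.+1%:R < y).
Proof.
rewrite lerBrDr (_ : k%:Z + 2 = k.+1%:Z + 1); last by lia.
by rewrite lezD1 ltNge ceil_le_int -ltNge.
Qed.

End Gap.

Theorem theorem1 (R : realType) (p : R) (hp0 : 0 < p) (hp1 : p < 1) (T : R) :
  (forall n : nat, (2 <= n)%N -> 1 <= T -> T <= n%:R ->
     ((opt_recovery_prob n p T - max_spread_prob n p T)%:E <=
      (p * T)%:E * binomial_prob n.-1 p
        [set k : nat | (k%:Z <= Num.ceil (n%:R / T) - 2)%R])%E)
  /\
  (p^-1 < T ->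
     (fun n : nat => opt_recovery_prob n p T - max_spread_prob n p T)
       @ \oo --> (0 : R)).
Proof.
have p01 : 0 <= p <= 1 by rewrite !ltW.
split=> [n n2 T1 Tn|pT].
  have T0 : 0 < T by apply: lt_le_trans T1.
  have [[x Ax <-] _] := opt_recovery_probP n p (ltW T0).
  rewrite binomial_prob_mean// -EFinM lee_fin.
  apply: le_trans (recovery_gap (ltnW n2) p01 Ax) _.
  (* Both events on k coincide, so this last bound is an equality. *)
  rewrite le_eqVlt; apply/orP; left; apply/eqP; congr (_ * _).
  apply: eq_bigr => k _; congr (_ * _%:R).
  by rewrite mem_setE -ltr_pdivlMr// -le_ceilB2.
have T0 : 0 < T by apply: lt_trans pT; rewrite invr_gt0.
have Tp : T^-1 < p by rewrite invf_plt.
pose C := p * (1 - p) / (p - T^-1) ^+ 2.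
apply: (@squeeze_cvgr _ _ _ _ (fun=> 0) (fun n => C * n%:R^-1)).
- near=> n; apply/andP; split; first exact: opt_gap_ge0 (ltW T0).
  apply: opt_gap_le => //.
  (* The upper bound needs n > 0, which holds eventually. *)
  by near: n; exact: nbhs_infty_gt.
- exact: cvg_cst.
- rewrite -[X in _ --> X](mulr0 C); apply: cvgMr.
  (* The harmonic sequence is 1 / (n + 1), hence the shift. *)
  by rewrite -cvg_shiftS; exact: cvg_harmonic.
Unshelve. all: by end_near.
Qed.
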